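(* Let $G$ be a finite abelian group of exponent $e$. Suppose there exists a set $\{d_i\}_{i=1}^n$ of pairwise relatively prime positive integers such that \[\sum_{i=1}^{n} \frac{1}{d_i}+\frac{1}{\prod_{i=1}^{n} d_i} =1\] and $e$ divides $\prod_{i=1}^{n} d_i$. Then there is an arithmetical structure on a star graph (that is, on $S_m$ for some $m$) whose critical group is isomorphic to $G$.
   Context: The exponent of a finite abelian group $\bigoplus_{k=1}^t \mathbb{Z}/m_k\mathbb{Z}$ is $\operatorname{lcm}(m_1,\dotsc,m_t)$. An arithmetical structure on a finite, connected, loopless graph $H$ with vertex set $V(H)$ is a pair $(\mathbf{d},\mathbf{r})$, where $\mathbf{r}=(r_v)_{v\in V(H)}$ consists of positive integers with no common factor, $\mathbf{d}=(d_v)_{v\in V(H)}$ consists of nonnegative integers, and for every vertex $v$ we have $r_vd_v=\sum r_u$, the sum being over all $u$ adjacent to $v$ (with multiplicity for multigraphs). Its critical group is the torsion part of the cokernel (over $\mathbb{Z}$) of the matrix $\operatorname{diag}(\mathbf{d})-A(H)$, where $A(H)$ is the adjacency matrix of $H$. The star graph $S_m$ has $m$ leaves, each joined by one edge to a central vertex (and no other edges). *)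

(* Defs.v *)
From HB Require Import structures.
From mathcomp Require Import all_boot all_order all_algebra.
From mathcomp Require Import all_fingroup all_solvable.
From mathcomp Require Import boolp.

Set Implicit Arguments.
Unset Strict Implicit.
Unset Printing Implicit Defensive.

Import GRing.Theory.

Local Open Scope ring_scope.

(* [adj u v] is the number of edges joining [u] and [v]; multiple edges are
   allowed. *)
Record multigraph (n : nat) := Multigraph {
  adj : 'M[nat]_n;
  adj_nonempty : (0 < n)%N;
  adj_sym : forall u v, adj u v = adj v u;
  adj_loopless : forall u, adj u u = 0%N;
  adj_connected : forall u v, connect (fun x y => (0 < adj x y)%N) u v
}.

(* The centre is [ord0]; the [m] other vertices are the leaves. *)
Definition star_adj (m : nat) : 'M[nat]_m.+1 :=
  \matrix_(u, v) nat_of_bool ((u == ord0) (+) (v == ord0)).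

Lemma star_adj_sym m u v : star_adj m u v = star_adj m v u.
Proof. by rewrite !mxE addbC. Qed.

Lemma star_adj_loopless m u : star_adj m u u = 0%N.
Proof. by rewrite mxE addbb. Qed.

Lemma star_adj_connected m u v :
  connect (fun x y => (0 < star_adj m x y)%N) u v.
Proof.
have to0 w : connect (fun x y => (0 < star_adj m x y)%N) w ord0.
  have [->|w0] := eqVneq w ord0; first exact: connect0.
  by apply: connect1; rewrite mxE eqxx (negPf w0).
apply: connect_trans (to0 u) _.
have [->|v0] := eqVneq v ord0; first exact: connect0.
by apply: connect1; rewrite mxE eqxx (negPf v0).
Qed.

Definition star (m : nat) : multigraph m.+1 :=
  Multigraph (ltn0Sn m) (@star_adj_sym m) (@star_adj_loopless m)
             (@star_adj_connected m).

Record arith_struct (n : nat) (H : multigraph n) := ArithStruct {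
  as_d : 'I_n -> nat;
  as_r : 'I_n -> nat;
  as_r_gt0 : forall v, (0 < as_r v)%N;
  as_r_gcd : \big[gcdn/0%N]_(v < n) as_r v = 1%N;
  as_eq : forall v,
    (as_r v * as_d v = \sum_(u < n) adj H v u * as_r u)%N
}.

Definition as_matrix n (H : multigraph n) (s : arith_struct H) : 'M[int]_n :=
  diag_mx (\row_v (as_d s v)%:Z) - map_mx Posz (adj H).

Definition mximage m n (L : 'M[int]_(m, n)) : {pred 'cV[int]_m} :=
  [pred x | `[< exists y : 'cV[int]_n, x = L *m y >]].

Lemma mximage_zmod_closed m n (L : 'M[int]_(m, n)) : zmod_closed (mximage L).
Proof.
split=> [|x y].
  by apply/asboolP; exists 0; rewrite mulmx0.
move=> /asboolP[a ->] /asboolP[b ->]; apply/asboolP.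
by exists (a - b); rewrite mulmxBr.
Qed.

HB.instance Definition _ m n (L : 'M[int]_(m, n)) :=
  GRing.isZmodClosed.Build 'cV[int]_m (mximage L) (mximage_zmod_closed L).

Definition coker m n (L : 'M[int]_(m, n)) : zmodType :=
  Quotient.quot (mximage L).

Definition torsion_pred (U : zmodType) : {pred U} :=
  [pred x | `[< exists2 k : nat, (0 < k)%N & x *+ k = 0 >]].

Lemma torsion_zmod_closed (U : zmodType) : zmod_closed (@torsion_pred U).
Proof.
split=> [|x y]; first by apply/asboolP; exists 1%N.
move=> /asboolP[k k0 kx] /asboolP[l l0 ly]; apply/asboolP.
exists (k * l)%N; first by rewrite muln_gt0 k0.
by rewrite mulrnBl mulrnA kx mul0rn mulnC mulrnA ly mul0rn subrr.
Qed.

HB.instance Definition _ (U : zmodType) :=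
  GRing.isZmodClosed.Build U (@torsion_pred U) (@torsion_zmod_closed U).

Record torsion (U : zmodType) := Torsion {
  torsion_val : U;
  torsion_valP : torsion_val \in @torsion_pred U
}.

HB.instance Definition _ (U : zmodType) := [isSub for @torsion_val U].
HB.instance Definition _ (U : zmodType) := [Choice of torsion U by <:].
HB.instance Definition _ (U : zmodType) :=
  [SubChoice_isSubZmodule of torsion U by <:].

Definition critical_group n (H : multigraph n) (s : arith_struct H) : zmodType :=
  torsion (coker (as_matrix s)).

(* [isog] relates two finite multiplicative groups, whereas [V] here is an
   additive group whose type carries no finiteness structure. *)
Definition isog_zmod (gT : finGroupType) (G : {set gT}) (V : zmodType) : Prop :=
  exists f : gT -> V,
    [/\ {in G &, forall x y, f (x * y)%g = f x + f y},
        {in G &, injective f}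
      & forall v, exists2 x, x \in G & f x = v].

(* Main.v *)
(** Write N = prod d_i and let m_0, ..., m_(t-1), all dividing N, be the orders
    of the cyclic factors of G.  For a divisor m of L = m P the identity
    1/L = 1/(m(P+1)) + 1/(L(P+1)) trades a leaf L for the two leaves m(P+1) and
    L(P+1).  Start from the leaves d_1, ..., d_n, N, whose reciprocals sum to 1
    and whose critical group is trivial, and apply this to the last leaf, once
    for each m_k: every step adds a factor Z/m_k to the critical group.  With x_v
    the class of the vertex v, centre 0, leaves i carrying d_i and y_k the leaf
    m_k(P_k+1), the new factor is generated by
    (P_k+1) x_(y_k) + (N/m_k) (sum_i x_i - x_0). *)
Require Import Defs.
From mathcomp Require Import all_boot all_order all_algebra.
From mathcomp Require Import all_fingroup all_solvable.
From mathcomp Require Import boolp ring.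

Import Order.TTheory GRing.Theory Num.Theory.

Local Open Scope ring_scope.

(** * Comparing a product of cyclic groups with an additive group *)

Lemma prodgM (gT : finGroupType) (G : {group gT}) (I : Type) (r : seq I)
    (F H : I -> gT) :
  abelian G -> (forall i, F i \in G) -> (forall i, H i \in G) ->
  (\prod_(i <- r) (F i * H i) = \prod_(i <- r) F i * \prod_(i <- r) H i)%g.
Proof.
move=> abG FG HG; elim: r => [|i r IH]; first by rewrite !big_nil mulg1.
have prodF : (\prod_(j <- r) F j)%g \in G by apply: group_prod => j _.
rewrite !big_cons IH -!mulgA; congr (_ * _)%g; rewrite !mulgA.
by congr (_ * _)%g; apply: (centsP abG).
Qed.

(** Both [G] and [V] are quotients of the lattice of integer rows by the same sublattice, the rows
    whose entry [k] is a multiple of the order of [g k]. Hence exponents can be transported from one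
    quotient to the other. *)
Lemma isog_zmod_bigdprod_cycle (gT : finGroupType) (G : {group gT})
    (abG : abelian G) (t : nat) (g : 'I_t -> gT)
    (defG : \big[dprod/1%g]_(k < t) <[g k]>%g = G)
    (V : zmodType) (theta : 'rV[int]_t -> V) :
  {morph theta : u v / u - v} ->
  (forall u, theta u = 0 <-> forall k, (#[g k]%g %| u ord0 k)%Z) ->
  (forall v, exists u, theta u = v) ->
  isog_zmod G V.
Proof.
move=> thetaB theta0 theta_surj.
have gG k : g k \in G.
  have /bigdprodWY <- := defG.
  by apply: mem_gen; apply/bigcupP; exists k; rewrite ?cycle_id.
pose word (e : 'I_t -> nat) := (\prod_(k < t) g k ^+ e k)%g.
have wordG e : word e \in G by apply: group_prod => k _; rewrite groupX.
have wordD e e' : (word e * word e' = word (fun k => e k + e' k)%N)%g.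
  rewrite /word -(prodgM _ G) // => [|k|k]; try by rewrite groupX.
  by apply: eq_bigr => k _; rewrite expgD.
have word_eq e e' : word e = word e' <-> forall k, e k = e' k %[mod #[g k]%g].
  have we : word e \in G by exact: wordG.
  have [c [_ _ uniq_c]] := mem_bigdprod defG we.
  have in_cycle (f : 'I_t -> nat) (k : 'I_t) :
    true -> (g k ^+ f k)%g \in <[g k]>%g by move=> _; exact: mem_cycle.
  split=> [eq_w k|eq_e].
    apply/eqP; rewrite -eq_expg_mod_order; apply/eqP.
    have -> := uniq_c _ (in_cycle e) (erefl _) k isT.
    by rewrite (uniq_c _ (in_cycle e') eq_w k isT).
  apply: eq_bigr => k _; apply/eqP.
  by rewrite eq_expg_mod_order; apply/eqP.
have word_surj x : x \in G -> exists e, x = word e.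
  move=> xG; have [c [c_in -> _]] := mem_bigdprod defG xG.
  have /boolp.choice [e eP] k : exists i, c k = (g k ^+ i)%g.
    exact/cycleP/c_in.
  by exists e; apply: eq_bigr => k _.
(* The chosen exponents need not be additive in [x]; [theta_vec] below makes the choice immaterial.
   Outside [G] the value 0 is a dummy. *)
have /boolp.choice [e eP] x : exists e, x \in G -> x = word e.
  have [xG|_] := boolP (x \in G); last by exists (fun=> 0%N).
  by have [e ->] := word_surj _ xG; exists e.
pose vec (f : 'I_t -> nat) : 'rV[int]_t := \row_k (f k)%:Z.
have theta_eq u v : theta u = theta v <-> forall k, (#[g k]%g %| u ord0 k - v ord0 k)%Z.
  split=> [uv k|uv].
    have /theta0/(_ k) : theta (u - v) = 0 by rewrite thetaB uv subrr.
    by rewrite !mxE.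
  apply/eqP; rewrite -subr_eq0 -thetaB; apply/eqP/theta0 => k.
  by rewrite !mxE.
have theta_00 : theta 0 = 0 by apply/theta0 => k; rewrite mxE dvdz0.
have thetaN u : theta (- u) = - theta u by rewrite -[- u]sub0r thetaB theta_00 sub0r.
have thetaD u v : theta (u + v) = theta u + theta v.
  by rewrite -{1}[v]opprK thetaB thetaN opprK.
have theta_vec f f' : theta (vec f) = theta (vec f') <-> word f = word f'.
  rewrite theta_eq word_eq.
  split=> H k; have := H k; rewrite !mxE -eqz_mod_dvd !modz_nat.
    by move/eqP=> [].
  by move->.
exists (fun x => theta (vec (e x))); split.
- move=> x y xG yG.
  rewrite -thetaD (_ : vec _ + vec _ = vec (fun k => e x k + e y k)%N).
    by apply/theta_vec; rewrite -eP ?groupM // -wordD -!eP.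
  by apply/rowP => k; rewrite !mxE PoszD.
- by move=> x y xG yG /theta_vec; rewrite -!eP.
- move=> v; have [u <-] := theta_surj v.
  (* [word] takes natural exponents, so the integer entries of [u] are first replaced by their
     residues modulo the orders. *)
  pose f k := `|(u ord0 k %% #[g k]%g)%Z|%N.
  exists (word f); first exact: wordG.
  have -> : theta (vec (e (word f))) = theta (vec f).
    by apply/theta_vec; rewrite -eP.
  apply/theta_eq => k; rewrite mxE /f gez0_abs ?modz_ge0 -?eqz_mod_dvd ?modz_mod //.
  by rewrite eqz_nat -lt0n order_gt0.
Qed.

(** * Torsion of a cokernel *)

Lemma pi_cokerP m n (L : 'M[int]_(m, n)) (x y : 'cV[int]_m) :
  \pi_({ideal_quot (mximage L)})%qT x = \pi_({ideal_quot (mximage L)})%qT y <->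
  exists z : 'cV[int]_n, x - y = L *m z.
Proof.
split=> [/eqP|xy]; last by apply/eqP; rewrite -Quotient.idealrBE; apply/asboolP.
by rewrite -Quotient.idealrBE => /asboolP.
Qed.

(** Here [T] lifts the required map to representatives: its two last hypotheses give the kernel and
    the surjectivity onto the torsion classes. *)
Lemma isog_zmod_torsion_coker (gT : finGroupType) (G : {group gT})
    (abG : abelian G) (t : nat) (g : 'I_t -> gT)
    (defG : \big[dprod/1%g]_(k < t) <[g k]>%g = G)
    m n (L : 'M[int]_(m, n)) (T : 'rV[int]_t -> 'cV[int]_m) :
  {morph T : u v / u - v} ->
  (forall u, (exists z, T u = L *m z) <-> forall k, (#[g k]%g %| u ord0 k)%Z) ->
  (forall y, (exists2 k, (0 < k)%N & exists z, y *+ k = L *m z) ->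
     exists u z, y - T u = L *m z) ->
  isog_zmod G (torsion (coker L)).
Proof.
move=> TB T_im T_tors.
have T0 : T 0 = 0 by rewrite -(subrr 0) TB subrr.
have TN u : T (- u) = - T u by rewrite -[- u]sub0r TB T0 sub0r.
have TD u v : T (u + v) = T u + T v by rewrite -{1}[v]opprK TB TN opprK.
have TMn u k : T (u *+ k) = T u *+ k.
  by elim: k => [|k IH]; rewrite ?mulr0n // !mulrS TD IH.
pose Q := {ideal_quot (mximage L)}; pose p x : Q := \pi_Q%qT x.
have p0 x : p x = 0 <-> exists z, x = L *m z.
  by rewrite -(raddf0 (\pi_Q)%qT) pi_cokerP subr0.
have p_tors u : p (T u) \in @torsion_pred Q.
  (* The product of all the orders is a common multiple of them, so it kills the class of every
     [T u] by [T_im]. *)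
  apply/asboolP; exists (\prod_k #[g k]%g)%N; first by rewrite prodn_gt0.
  rewrite -raddfMn; apply/p0; rewrite -TMn; apply/T_im => k.
  rewrite mulmxnE (bigD1 k) //= mulnC mulrnA -mulr_natr dvdz_mull //.
  by rewrite natz.
pose theta u : torsion (coker L) := @Torsion (coker L) (p (T u)) (p_tors u).
apply: (isog_zmod_bigdprod_cycle gT G abG t g defG (torsion (coker L)) theta).
- by move=> u v; apply/val_inj; rewrite raddfB /= /p TB raddfB.
- move=> u; rewrite -T_im -p0; split=> [/(congr1 val)|pu]; first by rewrite raddf0.
  by apply/val_inj; rewrite raddf0.
- case=> v v_tors.
  have [x xv] : exists x, p x = v by exists (generic_quotient.repr v); exact: reprK.
  have /asboolP[k k_gt0 vk] := v_tors.
  have [|u [z uz]] := T_tors x.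
    by exists k => //; apply/p0; rewrite /p raddfMn; move: vk; rewrite -xv.
  exists u; apply/val_inj => /=; rewrite -xv; apply/esym/pi_cokerP.
  by exists z.
Qed.

(** * Arithmetical structures on star graphs *)

(** The row [r] is in the left kernel of the matrix because the adjacency matrix is symmetric. *)
Lemma arith_struct_orth n (H : multigraph n) (s : arith_struct H) (z : 'cV[int]_n) :
  \sum_v (as_r s v)%:Z * (as_matrix s *m z) v ord0 = 0.
Proof.
pose r : 'rV[int]_n := \row_v (as_r s v)%:Z.
suff rL : r *m as_matrix s = 0.
  have : (r *m (as_matrix s *m z)) ord0 ord0 = 0.
    by rewrite mulmxA rL mul0mx mxE.
  by rewrite mxE; under eq_bigr => v _ do rewrite [r _ _]mxE.
apply/rowP => u; rewrite mulmxBr mul_mx_diag !mxE -PoszM as_eq.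
apply/eqP; rewrite subr_eq0 -natz natr_sum; apply/eqP/eq_bigr => v _.
by rewrite !mxE (adj_sym H v u) mulrC natz PoszM.
Qed.

Lemma star_imageP l (s : arith_struct (star l)) (y : 'cV[int]_l.+1) :
  (exists z, y = as_matrix s *m z) <->
  exists (z0 : int) (z : 'I_l -> int),
    y ord0 ord0 = (as_d s ord0)%:Z * z0 - \sum_j z j /\
    forall j, y (lift ord0 j) ord0 = (as_d s (lift ord0 j))%:Z * z j - z0.
Proof.
have L0 z : (as_matrix s *m z) ord0 ord0 =
    (as_d s ord0)%:Z * z ord0 ord0 - \sum_j z (lift ord0 j) ord0.
  rewrite mulmxBl mul_diag_mx !mxE big_ord_recl !mxE eqxx mul0r add0r.
  by congr (_ - _); apply: eq_bigr => j _; rewrite !mxE eqxx mul1r.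
have Lj z j : (as_matrix s *m z) (lift ord0 j) ord0 =
    (as_d s (lift ord0 j))%:Z * z (lift ord0 j) ord0 - z ord0 ord0.
  rewrite mulmxBl mul_diag_mx !mxE big_ord_recl !mxE eqxx mul1r.
  rewrite big1 ?addr0 // => i _; by rewrite !mxE mul0r.
split=> [[z ->]|[z0 [z [y0 yj]]]].
  by exists (z ord0 ord0), (fun j => z (lift ord0 j) ord0).
exists (\col_v oapp z z0 (unlift ord0 v)); apply/colP => v.
have [j|] := unliftP ord0 v => ->.
  by rewrite Lj yj !mxE liftK unlift_none.
by rewrite L0 y0 mxE unlift_none; under [in RHS]eq_bigr => j _ do rewrite mxE liftK.
Qed.

(** Take [R] at the centre and [R %/ a j] at leaf [j]. The leaf equations are then immediate, and
    the equation at the centre is [R] times the sum of reciprocals. Leaf [j0] receives the value 1,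
    which forces the gcd to be 1. *)
Lemma star_structure l (a : 'I_l -> nat) (c R : nat) (j0 : 'I_l) :
  (0 < R)%N -> a j0 = R -> (forall j, (a j %| R)%N) ->
  \sum_j ((a j)%:R : rat)^-1 = c%:R ->
  exists s : arith_struct (star l),
    as_d s ord0 = c /\ forall j, as_d s (lift ord0 j) = a j.
Proof.
move=> R_gt0 aj0 aR sum_inv_a.
have sum_a : (\sum_j R %/ a j = R * c)%N.
  apply/eqP; rewrite -(eqr_nat rat) natr_sum natrM -sum_inv_a mulr_sumr.
  by apply/eqP/eq_bigr => j _; rewrite natq_div.
pose dd v := oapp a c (unlift ord0 v).
pose r v := oapp (fun j => R %/ a j)%N R (unlift ord0 v).
have r_gt0 v : (0 < r v)%N.
  rewrite /r; case: (unlift _ _) => //= j.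
  by rewrite divn_gt0 ?(dvdn_leq R_gt0) // (dvdn_gt0 R_gt0).
have r_gcd : \big[gcdn/0%N]_(v < l.+1) r v = 1%N.
  apply/eqP; rewrite -dvdn1.
  apply: (@biggcdn_inf _ (lift ord0 j0)) => //.
  by rewrite /r liftK /= aj0 divnn R_gt0.
have r_eq v : (r v * dd v = \sum_(u < l.+1) adj (star l) v u * r u)%N.
  rewrite big_ord_recl; have [j|] := unliftP ord0 v => ->.
    rewrite !mxE {1}/r /dd liftK /= divnK //= mul1n {1}/r unlift_none /=.
    by rewrite big1 ?addn0 // => i _; rewrite mxE mul0n.
  rewrite !mxE {1}/r /dd unlift_none /= -sum_a mul0n add0n.
  by apply: eq_bigr => j _; rewrite mxE /r liftK /= mul1n.
exists (ArithStruct r_gt0 r_gcd r_eq).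
by split=> [|j]; rewrite /= /r /dd ?liftK ?unlift_none.
Qed.

(** Pairing [y *+ k] with [r] gives 0, and [k] cancels. At each leaf the product of the [r] and [d]
    values is the [r] value of the centre, so dividing by the latter leaves the weights 1/d. *)
Lemma star_torsion_degree l (s : arith_struct (star l)) (y : 'cV[int]_l.+1) (k : nat) :
  (0 < k)%N -> (exists z, y *+ k = as_matrix s *m z) ->
  (y ord0 ord0)%:~R +
    \sum_j (y (lift ord0 j) ord0)%:~R / ((as_d s (lift ord0 j))%:R : rat) = 0.
Proof.
move=> k_gt0 [z yz]; pose y' v : rat := (y v ord0)%:~R.
have r0 : (as_r s ord0)%:R != 0 :> rat by rewrite pnatr_eq0 -lt0n as_r_gt0.
have rj j : (as_r s (lift ord0 j) * as_d s (lift ord0 j) = as_r s ord0)%N.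
  rewrite as_eq big_ord_recl !mxE mul1n big1 ?addn0 // => i _.
  by rewrite mxE mul0n.
have orth : \sum_v (as_r s v)%:R * y' v = 0.
  have /(congr1 (fun x : int => x%:~R : rat)) := arith_struct_orth _ _ s z.
  rewrite -yz rmorph_sum /= rmorph0 => sum0.
  have k0 : k%:R != 0 :> rat by rewrite pnatr_eq0 -lt0n.
  apply: (mulfI k0); rewrite mulr0 -[RHS]sum0 mulr_sumr; apply: eq_bigr => v _.
  by rewrite mulmxnE rmorphM rmorphMn /= mulrCA; congr (_ * _); rewrite mulr_natl.
apply: (mulfI r0); rewrite mulr0 -[RHS]orth big_ord_recl mulrDr mulr_sumr.
congr (_ + _); apply: eq_bigr => j _; rewrite -(rj j) natrM /y'.
have /andP[rj0 dj0] : ((as_r s (lift ord0 j))%:R != 0 :> rat) &&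
    ((as_d s (lift ord0 j))%:R != 0 :> rat).
  by rewrite -negb_or -mulf_eq0 -natrM rj.
by field.
Qed.

(** * The leaves produced by repeated splitting *)

(** With L the last leaf after [k'] splittings and P = L / m, the next last leaf is L (P + 1). The
    division is exact once [m k'] divides [N], since [N] divides every later last leaf. *)
Fixpoint last_leaf (N : nat) (m : nat -> nat) (k : nat) : nat :=
  if k is k'.+1 then
    (last_leaf N m k' * (last_leaf N m k' %/ m k').+1)%N
  else N.

Definition extra_leaf (N : nat) (m : nat -> nat) (k : nat) : nat :=
  (m k * (last_leaf N m k %/ m k).+1)%N.

Lemma last_leaf_gt0 N m k : (0 < N)%N -> (0 < last_leaf N m k)%N.
Proof. by move=> N_gt0; elim: k => //= k IH; rewrite muln_gt0 IH. Qed.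

Lemma dvdn_last_leaf N m i k : (i <= k)%N -> (last_leaf N m i %| last_leaf N m k)%N.
Proof.
elim: k => [|k IH]; first by rewrite leqn0 => /eqP->.
by rewrite leq_eqVlt => /predU1P[->//|/IH ik] /=; apply: dvdn_mulr.
Qed.

(** Both leaves created by a splitting share the factor P + 1, and m divides L; so m (P + 1) divides
    L (P + 1), which is already the last leaf of index [i.+1]. *)
Lemma dvdn_extra_leaf N m i k : (m i %| N)%N -> (i < k)%N ->
  (extra_leaf N m i %| last_leaf N m k)%N.
Proof.
move=> mN ik; apply: dvdn_trans (dvdn_last_leaf N m _ _ ik).
by apply: dvdn_mul => //; apply: dvdn_trans mN (dvdn_last_leaf _ _ _ _ (leq0n i)).
Qed.

(** By induction on [t], each step being 1/(m (P + 1)) + 1/(L (P + 1)) = 1/L for L = m P. *)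
Lemma sum_extra_leaf N m t : (0 < N)%N -> (forall k, m k %| N)%N ->
  \sum_(k < t) ((extra_leaf N m k)%:R : rat)^-1 + (last_leaf N m t)%:R^-1 = N%:R^-1.
Proof.
move=> N_gt0 mN; elim: t => [|t IH]; first by rewrite big_ord0 add0r.
rewrite -IH big_ord_recr /= -addrA; congr (_ + _).
have mL : (m t %| last_leaf N m t)%N.
  exact: dvdn_trans (mN t) (dvdn_last_leaf _ _ _ _ (leq0n t)).
have L_gt0 := last_leaf_gt0 N m t N_gt0.
rewrite /extra_leaf; set L := last_leaf N m t in mL L_gt0 *.
have P_gt0 : (0 < L %/ m t)%N by rewrite divn_gt0 ?(dvdn_leq L_gt0) ?(dvdn_gt0 L_gt0).
rewrite -{2 4}(divnK mL) [(_ %/ _ * _)%N]mulnC !natrM -natr1.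
set p : rat := (L %/ m t)%:R; set q : rat := (m t)%:R.
have p_gt0 : 0 < p by rewrite ltr0n.
have q0 : q != 0 by rewrite pnatr_eq0 -lt0n (dvdn_gt0 N_gt0).
have p10 : p + 1 != 0 by rewrite gt_eqF // addr_gt0.
by field; rewrite p10 q0 gt_eqF.
Qed.

(** * Divisibility from integral sums of fractions *)

Lemma dvdz_ratP (n : nat) (x : int) : (0 < n)%N ->
  x%:~R / (n%:R : rat) \is a Num.int -> (n %| x)%Z.
Proof.
move=> n_gt0 /intrP[z xz]; apply/dvdzP; exists z.
apply/eqP; rewrite -(eqr_int rat) rmorphM /= -xz divfK //.
by rewrite pnatr_eq0 -lt0n.
Qed.

Lemma int_num_dvdn (a b : nat) (x : int) : (0 < a)%N -> (a %| b)%N ->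
  b%:R * (x%:~R / (a%:R : rat)) \is a Num.int.
Proof.
move=> a_gt0 /dvdnP[c ->]; have a0 : a%:R != 0 :> rat by rewrite pnatr_eq0 -lt0n.
by rewrite natrM mulrCA mulfK // rpredM ?intr_int ?natr_int.
Qed.

(** Multiplying by the product [c] of the other denominators makes every term but the one at [i]
    integral. So [d i] divides [c * x i], and it is coprime to [c]. *)
Lemma dvdz_coprime_sum n (d : 'I_n -> nat) (x : 'I_n -> int) :
  (forall i, 0 < d i)%N -> (forall i j, i != j -> coprime (d i) (d j)) ->
  \sum_i (x i)%:~R / ((d i)%:R : rat) \is a Num.int -> forall i, (d i %| x i)%Z.
Proof.
move=> d_gt0 d_co sum_int i; pose c := (\prod_(j | j != i) d j)%N.
have co : coprimez (d i) c.
  rewrite coprimezE /= /c; elim/big_ind: _ => [|a b ca cb|j ji]; first exact: coprimen1.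
    by rewrite coprimeMr ca.
  by apply: d_co; rewrite eq_sym.
rewrite -(Gauss_dvdzr _ co); apply: dvdz_ratP => //; rewrite rmorphM /= -pmulrn -mulrA.
have : c%:R * \sum_i (x i)%:~R / ((d i)%:R : rat) \is a Num.int.
  by rewrite rpredM ?natr_int.
rewrite (bigD1 i) //= mulrDr rpredDr // mulr_sumr rpred_sum // => j ji.
by apply: int_num_dvdn => //; rewrite /c (bigD1 j) //= dvdn_mulr.
Qed.

(* At t.+1 terms only the last denominator need not divide [last_leaf N m t], so
   the factors split off one at a time, from the last term down. *)
Lemma dvdz_extra_leaf_sum N m t (X : rat) (x : nat -> int) :
  (0 < N)%N -> (forall k, m k %| N)%N -> N%:R * X \is a Num.int ->
  X + \sum_(k < t) (x k)%:~R / (extra_leaf N m k)%:R \is a Num.int ->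
  forall k, (k < t)%N -> ((last_leaf N m k %/ m k).+1 %| x k)%Z.
Proof.
move=> N_gt0 mN; elim: t X => [//|t IH] X NX sum_int.
have mL : (m t %| last_leaf N m t)%N.
  exact: dvdn_trans (mN t) (dvdn_last_leaf _ _ _ _ (leq0n t)).
have L_gt0 := last_leaf_gt0 N m t N_gt0.
have m_gt0 k : (0 < m k)%N by exact: dvdn_gt0 (mN k).
set P := (last_leaf N m t %/ m t)%N.
have LX : (last_leaf N m t)%:R * X \is a Num.int.
  have /dvdnP[c ->] := dvdn_last_leaf N m 0 t (leq0n t).
  by rewrite natrM -mulrA rpredM ?natr_int.
have m0 : (m t)%:R != 0 :> rat by rewrite pnatr_eq0 -lt0n.
have P0 : P.+1%:R != 0 :> rat by rewrite pnatr_eq0.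
(* Multiplication by L = m P clears all earlier denominators and turns the last term into P x / (P +
   1), where P and P + 1 are coprime. *)
have qx : (P.+1 %| x t)%Z.
  have co : coprimez P.+1 P by rewrite coprimezE /= coprimeSn.
  rewrite -(Gauss_dvdzr _ co); apply: dvdz_ratP => //.
  have := rpredM (natr_int _ (last_leaf N m t)) sum_int.
  rewrite big_ord_recr /= !mulrDr (rpredDl _ LX) rpredDl; last first.
    rewrite mulr_sumr rpred_sum // => k _; apply: int_num_dvdn.
      by rewrite muln_gt0 m_gt0.
    exact: dvdn_extra_leaf.
  suff -> : (last_leaf N m t)%:R * ((x t)%:~R / (extra_leaf N m t)%:R) =
            (P%:Z * x t)%:~R / P.+1%:R :> rat by [].
  rewrite /extra_leaf -/P -{1}(divnK mL) -/P !natrM rmorphM /= -pmulrn.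
  by field; rewrite m0 addrC natr1 P0.
move=> k; rewrite ltnS leq_eqVlt => /predU1P[->//|].
(* Since P + 1 divides [x t], the last term has denominator [m t], a divisor of [N], and can be
   absorbed into [X]. *)
apply: (IH (X + (x t)%:~R / (extra_leaf N m t)%:R)).
  have /dvdzP[c ->] := qx.
  rewrite mulrDr rpredD // /extra_leaf -/P natrM rmorphM /= -pmulrn.
  rewrite -[_ / _]mulrA invfM [(m t)%:R^-1 * _]mulrC mulVKf //.
  exact: int_num_dvdn.
rewrite -addrA [_ / _ + _]addrC.
by rewrite -(big_ord_recr _ (fun k => (x k)%:~R / (extra_leaf N m k)%:R)).
Qed.

(** * Indexing the leaves of the final star *)

(** The order is: the [n] original leaves, the last leaf, the [t] extra leaves. The type [A] varies
    because both leaf labels and coordinate vectors are built this way. *)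
Definition split_leaf (A : Type) n t (f : 'I_n -> A) (h : 'I_t -> A) (c : A)
    (j : 'I_(n + t.+1)) : A :=
  match split j with inl i => f i | inr k => oapp h c (unlift ord0 k) end.

Lemma split_leafE A n t (f : 'I_n -> A) (h : 'I_t -> A) c :
  [/\ forall i, split_leaf A n t f h c (lshift t.+1 i) = f i,
      forall k, split_leaf A n t f h c (rshift n (lift ord0 k)) = h k
    & split_leaf A n t f h c (rshift n ord0) = c].
Proof.
split=> [i|k|]; rewrite /split_leaf.
- by rewrite (unsplitK (inl i)).
- by rewrite (unsplitK (inr (lift ord0 k))) liftK.
- by rewrite (unsplitK (inr ord0)) unlift_none.
Qed.

Lemma split_leaf_ind n t (P : 'I_(n + t.+1) -> Prop) :
  (forall i, P (lshift t.+1 i)) -> (forall k, P (rshift n (lift ord0 k))) ->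
  P (rshift n ord0) -> forall j, P j.
Proof.
move=> Pl Pr P0 j; rewrite -[j]splitK; case: (split j) => [i|k] //=.
by have [k' ->|->] := unliftP ord0 k.
Qed.

Lemma sum_split_leaf (V : nmodType) n t (F : 'I_(n + t.+1) -> V) :
  \sum_j F j = \sum_(i < n) F (lshift t.+1 i) +
               (F (rshift n ord0) + \sum_(k < t) F (rshift n (lift ord0 k))).
Proof. by rewrite big_split_ord big_ord_recl. Qed.

(** * Computing the critical group of the split star *)

Lemma star_realization (gT : finGroupType) (G : {group gT}) (abG : abelian G)
    (t : nat) (g : 'I_t -> gT) (m : nat -> nat) (n : nat) (d : 'I_n -> nat) :
  \big[dprod/1%g]_(k < t) <[g k]>%g = G ->
  (forall k : 'I_t, #[g k]%g = m k) ->
  (forall k, m k %| \prod_i d i)%N ->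
  (forall i, 0 < d i)%N -> (forall i j, i != j -> coprime (d i) (d j)) ->
  \sum_i ((d i)%:R : rat)^-1 + ((\prod_i d i)%N%:R)^-1 = 1 ->
  exists l (s : arith_struct (star l)), isog_zmod G (critical_group s).
Proof.
set N := (\prod_i d i)%N => defG ord_g mN d_gt0 d_co d_sum.
have N_gt0 : (0 < N)%N by rewrite prodn_gt0.
have m_gt0 k : (0 < m k)%N by exact: dvdn_gt0 (mN k).
have dN i : (d i %| N)%N by rewrite /N (bigD1 i) //= dvdn_mulr.
pose R := last_leaf N m t; pose b (k : 'I_t) := extra_leaf N m k.
pose q (k : 'I_t) := (last_leaf N m k %/ m k).+1.
have bE k : b k = (m k * q k)%N by [].
have R_gt0 : (0 < R)%N by exact: last_leaf_gt0.
have bR k : (b k %| R)%N by exact: dvdn_extra_leaf.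
have dR i : (d i %| R)%N by exact: dvdn_trans (dN i) (dvdn_last_leaf N m 0 t _).
have sum_b : \sum_k ((b k)%:R : rat)^-1 + R%:R^-1 = N%:R^-1 by exact: sum_extra_leaf.
pose a := split_leaf nat n t d b R.
have [] := split_leafE nat n t d b R; rewrite -/a => a_d a_b a_R.
have [s [s0 sa]] : exists s : arith_struct (star (n + t.+1)),
    as_d s ord0 = 1%N /\ forall j, as_d s (lift ord0 j) = a j.
  apply: (star_structure _ a 1 R (rshift n ord0) R_gt0 a_R).
    by apply: split_leaf_ind => [i|k|]; rewrite ?a_d ?a_b ?a_R ?dR ?bR.
  rewrite sum_split_leaf a_R -[RHS]d_sum; congr (_ + _).
    by apply: eq_bigr => i _; rewrite a_d.
  by rewrite -sum_b addrC; congr (_ + _); apply: eq_bigr => k _; rewrite a_b.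
exists (n + t.+1)%N, s.
(* [T u] is the combination, with coefficients [u], of the proposed generators: [E u] collects the
   multiples N / m_k of the part shared by all of them. *)
pose E (u : 'rV[int]_t) : int := \sum_k u ord0 k * (N %/ m k)%:Z.
have EB u v : E (u - v) = E u - E v.
  by rewrite -sumrB; apply: eq_bigr => k _; rewrite !mxE mulrBl.
pose T (u : 'rV[int]_t) : 'cV[int]_(n + t.+1).+1 :=
  \col_v oapp (split_leaf int n t (fun=> E u) (fun k => (q k)%:Z * u ord0 k) 0)
              (- E u) (unlift ord0 v).
have TE u := split_leafE int n t (fun=> E u) (fun k => (q k)%:Z * u ord0 k) 0.
have T0 u : T u ord0 ord0 = - E u by rewrite mxE unlift_none.
have Td u i : T u (lift ord0 (lshift t.+1 i)) ord0 = E u.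
  by rewrite mxE liftK /=; have [-> _ _] := TE u.
have Tb u k : T u (lift ord0 (rshift n (lift ord0 k))) ord0 = (q k)%:Z * u ord0 k.
  by rewrite mxE liftK /=; have [_ -> _] := TE u.
have TR u : T u (lift ord0 (rshift n ord0)) ord0 = 0.
  by rewrite mxE liftK /=; have [_ _ ->] := TE u.
have nat0 k : (0 < k)%N -> k%:R != 0 :> rat by rewrite pnatr_eq0 -lt0n.
have E_rat u : (E u)%:~R / N%:R = \sum_k (u ord0 k)%:~R / ((m k)%:R : rat).
  rewrite rmorph_sum mulr_suml; apply: eq_bigr => k _.
  rewrite rmorphM /= -pmulrn natq_div //.
  by field; rewrite !nat0.
have T_eq u (y : 'cV[int]_(n + t.+1).+1) :
    y ord0 ord0 = - E u ->
    (forall i, y (lift ord0 (lshift t.+1 i)) ord0 = E u) ->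
    (forall k, y (lift ord0 (rshift n (lift ord0 k))) ord0 = (q k)%:Z * u ord0 k) ->
    y (lift ord0 (rshift n ord0)) ord0 = 0 -> y = T u.
  move=> y0 yd yb yR; apply/colP => v; have [j|] := unliftP ord0 v => ->.
    by move: j; apply: split_leaf_ind => [i|k|]; rewrite ?yd ?yb ?yR ?Td ?Tb ?TR.
  by rewrite y0 T0.
apply: (isog_zmod_torsion_coker gT G abG t g defG _ _ (as_matrix s) T).
- move=> u v; have TBE i : (T u - T v) i ord0 = T u i ord0 - T v i ord0.
    by rewrite !mxE.
  apply/esym/T_eq => [|i|k|]; rewrite TBE ?T0 ?Td ?Tb ?TR ?EB.
  + by rewrite opprD.
  + by [].
  + by rewrite !mxE mulrBr.
  + by rewrite subr0.
- move=> u; rewrite star_imageP s0; split=> [[z0 [z [_ zj]]] k|mu].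
    (* The row of the last leaf makes [z0] a multiple of [R], hence of each [b k]. The row of the
       extra leaf then gives m q | q u, and [q k] cancels. *)
    have := zj (rshift n ord0); rewrite TR sa a_R => /esym/eqP.
    rewrite subr_eq0 => /eqP z0R.
    have := zj (rshift n (lift ord0 k)); rewrite Tb sa a_b -z0R => qu.
    have : (b k %| (q k)%:Z * u ord0 k)%Z.
      by rewrite qu rpredB // dvdz_mulr // dvdzE bR.
    by rewrite bE ord_g mulnC PoszM dvdz_mul2l.
  have /fin_all_exists [c uc] k : exists c : int, u ord0 k = c * (m k)%:Z.
    by apply/dvdzP; rewrite -ord_g.
  pose S := \sum_k c k.
  have ES : E u = S * N%:Z.
    rewrite mulr_suml; apply: eq_bigr => k _.
    by rewrite uc -mulrA -PoszM mulnC divnK.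
  (* With [z0 = 0] each leaf row determines its own coefficient by division. *)
  pose z := split_leaf int n t (fun i => S * (N %/ d i)%:Z) c 0.
  have [] := split_leafE int n t (fun i => S * (N %/ d i)%:Z) c 0.
  rewrite -/z => z_d z_b z_R.
  exists 0, z; split.
    rewrite T0 mulr0 add0r; congr (- _); apply/eqP.
    rewrite -(eqr_int rat) sum_split_leaf z_R add0r.
    rewrite (eq_bigr (fun i => S * (N %/ d i)%:Z)) => [|i _]; last exact: z_d.
    rewrite (eq_bigr c) => [|k _]; last exact: z_b.
    rewrite -/S -mulr_sumr ES -[X in _ + X]mulr1 -mulrDr !rmorphM /=.
    apply/eqP; congr (_ * _).
    (* The centre row reduces to the hypothesis on the [d i] multiplied by [N]: the sum of the N /
       d_i plus 1 is N. *)
    have := congr1 ( *%R N%:R) d_sum.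
    rewrite mulrDr mulr1 divff ?nat0 // mulr_sumr => sumN.
    rewrite rmorphD /= rmorph_sum /= -[LHS]pmulrn -sumN.
    congr (_ + _); apply: eq_bigr => i _.
    by rewrite -pmulrn natq_div.
  apply: split_leaf_ind => [i|k|]; rewrite ?Td ?Tb ?TR subr0 sa.
  + by rewrite a_d z_d ES mulrCA -PoszM mulnC divnK.
  + by rewrite a_b z_b uc bE PoszM; ring.
  + by rewrite z_R mulr0.
move=> y [k k_gt0 y_im]; pose y0 := y ord0 ord0.
pose y' j := y (lift ord0 j) ord0; pose w := y' (rshift n ord0).
pose yd i := y' (lshift t.+1 i); pose yb k := y' (rshift n (lift ord0 k)).
have := star_torsion_degree _ s y k k_gt0 y_im.
rewrite sum_split_leaf sa a_R -/y0 -/(y' _) -/w.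
under eq_bigr => i _ do rewrite sa a_d -/(y' _) -/(yd i).
under [X in _ + (_ + (_ + X))]eq_bigr => i _ do rewrite sa a_b -/(y' _) -/(yb i).
have inv_d : \sum_i ((d i)%:R : rat)^-1 = 1 - N%:R^-1.
  by apply/eqP; rewrite eq_sym subr_eq d_sum.
move=> y_deg; pose X : rat := \sum_i (yd i - w)%:~R / (d i)%:R.
(* Adding [w] times the column of the centre to [y] makes the coordinate at the last leaf 0, lowers
   the other leaves by [w] and raises the centre by [w]. The identity is the vanishing degree of
   this new vector. *)
have sumX : X + \sum_k (yb k - w)%:~R / (b k)%:R = (- y0 - w)%:~R.
  pose A : rat := \sum_i (yd i)%:~R / (d i)%:R.
  pose B : rat := \sum_k (yb k)%:~R / (b k)%:R.
  have -> : X = A - w%:~R * \sum_i (d i)%:R^-1.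
    rewrite mulr_sumr -sumrB; apply: eq_bigr => i _.
    by rewrite rmorphB mulrBl.
  have -> : \sum_k (yb k - w)%:~R / ((b k)%:R : rat) = B - w%:~R * \sum_k (b k)%:R^-1.
    rewrite mulr_sumr -sumrB; apply: eq_bigr => i _.
    by rewrite rmorphB mulrBl.
  have -> : \sum_k ((b k)%:R : rat)^-1 = N%:R^-1 - R%:R^-1 by rewrite -sum_b addrK.
  rewrite inv_d.
  move: y_deg; rewrite -/A -/B rmorphB rmorphN /= => y_deg.
  apply/eqP; rewrite -subr_eq0 -y_deg; apply/eqP; ring.
(* The differences are extended by 0 to all natural indices, to fit [dvdz_extra_leaf_sum]. *)
pose xb k : int := oapp (fun k => yb k - w) 0 (insub k).
have xbE (j : 'I_t) : xb j = yb j - w by rewrite /xb valK.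
have NX : N%:R * X \is a Num.int.
  by rewrite mulr_sumr rpred_sum // => i _; apply: int_num_dvdn.
have q_xb : forall j, (j < t)%N -> ((last_leaf N m j %/ m j).+1 %| xb j)%Z.
  apply: (dvdz_extra_leaf_sum N m t X xb N_gt0 mN NX).
  by under eq_bigr => j _ do rewrite xbE; rewrite [_ + _]sumX intr_int.
have /fin_all_exists [c yc] j : exists c : int, yb j - w = c * (q j)%:Z.
  by apply/dvdzP; rewrite -xbE; apply: q_xb.
(* With these quotients [T u] agrees with the shifted [y] on the extra leaves and on the last
   leaf. *)
pose u : 'rV[int]_t := \row_j c j; exists u.
have Ew : (E u)%:~R / N%:R = \sum_k (yb k - w)%:~R / ((b k)%:R : rat).
  rewrite E_rat; apply: eq_bigr => j _; rewrite mxE yc bE natrM rmorphM /= -pmulrn.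
  by field; rewrite !nat0.
(* By [inv_d], subtracting [E u] at every original leaf changes the sum by -E + E/N. The part E/N is
   the contribution of the extra leaves, so [sumX] yields an integer and coprimality applies
   termwise. *)
have sum_d : \sum_i (yd i - w - E u)%:~R / ((d i)%:R : rat) = (- y0 - w - E u)%:~R.
  rewrite rmorphB /= -sumX -Ew.
  under eq_bigr => i _ do rewrite rmorphB mulrBl.
  rewrite sumrB -mulr_sumr -/X inv_d.
  ring.
have /fin_all_exists [e ye] i : exists e : int, yd i - w - E u = e * (d i)%:Z.
  apply/dvdzP; move: i; apply: dvdz_coprime_sum => //.
  by rewrite sum_d intr_int.
have sum_e : \sum_i e i = - y0 - w - E u.
  apply/eqP; rewrite -(eqr_int rat) -sum_d rmorph_sum; apply/eqP/eq_bigr => i _.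
  by rewrite ye rmorphM /= -pmulrn mulfK ?nat0.
have [] := split_leafE int n t e (fun=> 0) 0.
set z := split_leaf int n t e _ _ => z_d z_b z_R.
have TBE i : (y - T u) i ord0 = y i ord0 - T u i ord0 by rewrite !mxE.
(* The central coefficient [- w] undoes the earlier shift by [w]. *)
apply/star_imageP; exists (- w), z; split.
  rewrite TBE T0 s0 sum_split_leaf z_R add0r mul1r.
  rewrite (eq_bigr e) => [|i _]; last exact: z_d.
  rewrite sum_e big1 => [|j _]; last exact: z_b.
  by rewrite -/y0; ring.
apply: split_leaf_ind => [i|j|]; rewrite TBE ?Td ?Tb ?TR sa -/(y' _).
- rewrite a_d z_d mulrC -ye /yd; ring.
- by rewrite z_b mxE mulr0 mulrC -yc /yb; ring.
- by rewrite z_R -/w; ring.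
Qed.

Theorem proposition17 (gT : finGroupType) (G : {group gT}) (abG : abelian G)
    (n : nat) (d : 'I_n -> nat)
    (d_gt0 : forall i, (0 < d i)%N)
    (d_coprime : forall i j, i != j -> coprime (d i) (d j))
    (d_sum : \sum_(i < n) ((d i)%:R : rat)^-1
               + ((\prod_(i < n) d i)%N%:R : rat)^-1 = 1)
    (exp_dvd : (exponent G %| \prod_(i < n) d i)%N) :
  exists (m : nat) (s : arith_struct (star m)),
    isog_zmod G (critical_group s).
Proof.
have [b defG _] := abelian_structure abG.
(* The bound is stated for every natural [k], as the leaf recursion runs over a total sequence;
   beyond the end of [b] the default is the identity, of order 1. *)
have ord_dvd k : (#[nth 1%g b k]%g %| \prod_i d i)%N.
  apply: dvdn_trans exp_dvd; have [kb|bk] := ltnP k (size b).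
    apply: dvdn_exponent; rewrite -(bigdprodWY defG) mem_gen // bigcup_seq.
    by apply/bigcupP; exists (nth 1%g b k); rewrite ?mem_nth ?cycle_id.
  by rewrite nth_default // order1 dvd1n.
rewrite (big_nth 1%g) big_mkord in defG.
by apply: (star_realization gT G abG (size b) (fun k => nth 1%g b k)
             (fun k => #[nth 1%g b k]%g) n d).
Qed.
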